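(* For any $n\ge 1$ and $m\ge 1$, the equation $(-\Delta)^m u=e^u$ in $\mathbb{R}^n$ admits no entire solutions bounded from below.
   Context: An entire solution is a classical solution defined for all $x\in\mathbb{R}^n$ (not necessarily radial). *)

(* Defs.v *)
From HB Require Import structures.
From mathcomp Require Import all_boot all_order all_algebra.
From mathcomp Require Import all_classical all_reals all_analysis.
Set Implicit Arguments.
Unset Strict Implicit.
Unset Printing Implicit Defensive.
Import Order.TTheory GRing.Theory Num.Theory.
Import numFieldNormedType.Exports.
Local Open Scope classical_set_scope.
Local Open Scope ring_scope.

(* R^n is 'rV[R]_n; its library norm is the sup norm, but the notions below
   depend only on the topology and on the coordinates. *)

Definition partial (R : realType) (n : nat) (i : 'I_n) (f : 'rV[R]_n -> R) :
    'rV[R]_n -> R :=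
  fun x => 'D_(delta_mx 0 i) f x.

(* C^k(R^n): all iterated partial derivatives of order at most k, in any order
   of differentiation, exist everywhere and are continuous. *)
Fixpoint Ck (R : realType) (n k : nat) (f : 'rV[R]_n -> R) : Prop :=
  continuous f /\
  match k with
  | 0%N => True
  | k'.+1 => forall i : 'I_n,
      (forall x, derivable f x (delta_mx 0 i)) /\ Ck k' (partial i f)
  end.

Definition laplacian (R : realType) (n : nat) (f : 'rV[R]_n -> R) :
    'rV[R]_n -> R :=
  fun x => \sum_(i < n) partial i (partial i f) x.

Definition polylaplacian (R : realType) (n m : nat) (f : 'rV[R]_n -> R) :
    'rV[R]_n -> R :=
  iter m (fun g x => - laplacian g x) f.

(* Classical solution on all of R^n of (-Delta)^m u = e^u. *)
Definition entire_solution (R : realType) (n m : nat) (u : 'rV[R]_n -> R) :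
    Prop :=
  Ck (2 * m)%N u /\ forall x, polylaplacian m u x = expR (u x).

(* Main.v *)
Require Import Defs.
From HB Require Import structures.
From mathcomp Require Import all_boot all_order all_algebra.
From mathcomp Require Import all_classical all_reals all_analysis.
From mathcomp Require Import ring lra zify.
Import Order.TTheory GRing.Theory Num.Theory.
Import numFieldNormedType.Exports.
Local Open Scope classical_set_scope.
Local Open Scope ring_scope.

(** The proof is the nonlinear capacity (test function) method. If [u] is
    bounded below then [e^u >= c (1 + u^2)] for some [c > 0], so
    [(-Delta)^m u >= c (1 + u^2)]. Let [<.>] be the average over the cube
    [[-L, L]^n] and let [phi >= 0] be a test function of height 1 supported in
    the ball of radius [L]. Moving the derivatives onto [phi],
      [c <phi (1 + u^2)> <= <u (-Delta)^m phi>],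
    where [(-Delta)^m phi] has size [L^(-2m)]. If moreover
    [|(-Delta)^m phi| <= C L^(-2m) sqrt phi], the square [c phi u^2] absorbs the
    right-hand side up to [(C L^(-2m))^2 / (4c)], and
      [c <phi> <= (C L^(-2m))^2 / (4c)].
    By scaling [<phi>] is bounded below independently of [L], so that letting
    [L] tend to infinity gives a contradiction.

    The test function is a power of [g = max(0, 1 - |x|^2/L^2)]. Where it is
    smooth enough, [Delta (g^k)] is again a combination of powers of [g]:
      [L^2 Delta g^k = 4k(k-1) (g^(k-2) - g^(k-1)) - 2nk g^(k-1)]
    ([laplacian_bumpX]), hence all iterated Laplacians of a high power of [g]
    stay in the span of the powers of [g], with an explicit vanishing order at
    the sphere; this gives the square root bound for [phi = g^(4m+2)]
    ([polylaplacian_duality]).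

    The average [<.>] is taken over the nodes of a regular grid whose mesh tends
    to 0, and integration by parts becomes a statement modulo functions with
    vanishing limit average ([null]). The only analytic fact needed is that a
    partial derivative of a [C^1] function vanishing on the faces of the cube
    is null ([null_partial]): up to a uniformly small error the derivative is a
    difference quotient, and the sum of the differences over the grid is 0
    because the grid is invariant under the cyclic shift. Green's formula
    ([laplacian_green]) follows from it, since
    [phi Delta w - w Delta phi] is a divergence. *)

Set Implicit Arguments.
Unset Strict Implicit.
Unset Printing Implicit Defensive.

(** * Differences along a line *)

Section Lines.
Variables (R : realType) (V : normedModType R).

(** A directional derivative is an ordinary derivative along the line, so that
    the one-variable mean value theorem and chain rule apply to it. *)
Lemma is_derive_line (f : V -> R) (x v : V) (t df : R) :
  is_derive (t *: v + x) v f df <->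
  is_derive t (1 : R) (fun s : R => f (s *: v + x)) df.
Proof.
have E : (fun h : R => h^-1 *: (f (h *: v + (t *: v + x)) - f (t *: v + x))) =
  (fun h : R => h^-1 *: (f ((h *: (1 : R) + t) *: v + x) - f (t *: v + x))).
  by apply/funext => h; rewrite scalerDl addrA /GRing.scale /= mulr1.
split=> -[D1 D2]; split.
- by move: D1; rewrite /derivable E.
- by rewrite -D2 /derive E.
- by rewrite /derivable E.
- by rewrite -D2 /derive E.
Qed.

Lemma line_MVT (f : V -> R) (v x : V) (h : R) : 0 <= h ->
  (forall y, derivable f y v) ->
  exists2 t, 0 <= t <= h & f (h *: v + x) - f x = 'D_v f (t *: v + x) * h.
Proof.
move=> h0 df.
have dg (t : R) : is_derive t (1 : R) (fun s : R => f (s *: v + x))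
    ('D_v f (t *: v + x)).
  by apply/is_derive_line; exact: derivableP.
have cg : {within `[0, h], continuous (fun s : R => f (s *: v + x))}.
  apply: continuous_subspaceT => t.
  apply: differentiable_continuous; apply/derivable1_diffP.
  exact: (@ex_derive _ _ _ _ _ _ _ (dg t)).
have [t th] := MVT_segment h0 (fun t _ => dg t) cg.
rewrite scale0r add0r subr0 => E; exists t => //.
Qed.

End Lines.

(** * Grid averages and null functions *)

Section Averages.
Variables (R : realType) (n : nat).
Implicit Types (f g : 'rV[R]_n -> R) (L : R) (P : nat).

(** The grid has [P.+2] nodes per axis rather than [P] because ['I_P.+2] is a
    ring, hence has a cyclic shift. It contains the faces [x_i = -L] of the cube
    but not the faces [x_i = L]. *)
Definition node L P (k : {ffun 'I_n -> 'I_P.+2}) : 'rV[R]_n :=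
  \row_i (L * (2 * (k i)%:R / P.+2%:R - 1)).

Definition mean L f P : R :=
  (\sum_(k : {ffun 'I_n -> 'I_P.+2}) f (node L k)) /
  #|{ffun 'I_n -> 'I_P.+2}|%:R.

(** For continuous [f] this says that the integral of [f] over the cube is 0. *)
Definition null L f := mean L f P @[P --> \oo] --> 0.

Lemma card_nodes_gt0 P : (0 : R) < #|{ffun 'I_n -> 'I_P.+2}|%:R.
Proof. by rewrite ltr0n card_ffun card_ord expn_gt0. Qed.

Lemma meanD L f g P : mean L (fun x => f x + g x) P = mean L f P + mean L g P.
Proof. by rewrite /mean big_split /= mulrDl. Qed.

Lemma meanZ L (a : R) f P : mean L (fun x => a * f x) P = a * mean L f P.
Proof. by rewrite /mean -mulr_sumr mulrA. Qed.

Lemma mean_cst L (a : R) P : mean L (fun=> a) P = a.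
Proof.
rewrite /mean sumr_const -[a *+ _]mulr_natr mulfK //.
by rewrite gt_eqF// card_nodes_gt0.
Qed.

Lemma ler_mean L f g P :
  (forall k, f (@node L P k) <= g (node L k)) -> mean L f P <= mean L g P.
Proof.
by move=> fg; rewrite ler_pM2r ?invr_gt0 ?card_nodes_gt0 //; exact: ler_sum.
Qed.

Lemma null0 L : null L (fun=> 0).
Proof.
rewrite /null (_ : mean L _ = fun=> 0); first exact: cvg_cst.
by apply/funext => P; exact: mean_cst.
Qed.

Lemma nullD L f g : null L f -> null L g -> null L (fun x => f x + g x).
Proof.
move=> nf ng; rewrite /null (_ : mean L _ = fun P => mean L f P + mean L g P).
  by rewrite -[X in _ --> X]addr0; exact: cvgD.
by apply/funext => P; rewrite meanD.
Qed.

Lemma nullZ L (a : R) f : null L f -> null L (fun x => a * f x).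
Proof.
move=> nf; rewrite /null (_ : mean L _ = fun P => a * mean L f P).
  by rewrite -[X in _ --> X](mulr0 a); exact: cvgM (cvg_cst a) nf.
by apply/funext => P; rewrite meanZ.
Qed.

Lemma null_sum L (I : Type) (r : seq I) (F : I -> 'rV[R]_n -> R) :
  (forall i, null L (F i)) -> null L (fun x => \sum_(i <- r) F i x).
Proof.
move=> nF; elim: r => [|i r IH].
  by under eq_fun do rewrite big_nil; exact: null0.
by under eq_fun do rewrite big_cons; apply: nullD.
Qed.

Definition box L : set 'rV[R]_n := [set x | forall i, `|x 0 i| <= L].

Lemma node_box L P (k : {ffun 'I_n -> 'I_P.+2}) : 0 <= L -> box L (node L k).
Proof.
move=> L0 i; rewrite mxE normrM (ger0_norm L0) ler_piMr //.
have k0 : 0 <= (k i)%:R / P.+2%:R :> R by rewrite divr_ge0.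
have k1 : (k i)%:R / P.+2%:R <= 1 :> R.
  by rewrite ler_pdivrMr ?ltr0n // mul1r ler_nat ltnW.
rewrite ler_norml -mulrA; set q := _ / _ in k0 k1 *.
by apply/andP; split; lra.
Qed.

Lemma box_compact L : compact (box L).
Proof.
have -> : box L = [set v : 'rV[R]_n | forall i, `[- L, L]%classic (v ord0 i)].
  apply/seteqP; split => x /= xL i; have := xL i;
    by rewrite /= in_itv /= ?ler_norml.
apply: (@rV_compact _ n (fun=> `[- L, L]%classic)) => i.
exact: segment_compact.
Qed.

Lemma near_step_lt L (d : R) : 0 < L -> 0 < d ->
  \forall P \near \oo, 2 * L / P.+2%:R < d.
Proof.
move=> L0 d0.
have e0 : 0 < d / (2 * L) by rewrite divr_gt0 // mulr_gt0.
have := near_infty_natSinv_lt (PosNum e0).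
apply: filterS => P /= Pd.
rewrite -ltr_pdivlMl ?mulr_gt0 // mulrC; apply: le_lt_trans Pd.
by rewrite lef_pV2 ?posrE ?ltr0n // ler_nat.
Qed.

(** Uniform continuity on the compact cube, for translations by at most one
    mesh step in a fixed direction. *)
Lemma near_box_translate L (v : 'rV[R]_n) f (e : R) :
    0 < L -> continuous f -> 0 < e ->
  \forall P \near \oo, forall x, box L x -> forall t : R,
    0 <= t <= 2 * L / P.+2%:R -> `|f (t *: v + x) - f x| <= e.
Proof.
move=> L0 cf e0.
have /compact_near_coveringP := @box_compact L.
move=> /(_ nat \oo (fun P x => forall t : R, 0 <= t <= 2 * L / P.+2%:R ->
    `|f (t *: v + x) - f x| <= e)); apply=> x _.
have e2 : 0 < e / 2 by rewrite divr_gt0.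
have [d /= d0 dx] : exists2 d : R, 0 < d &
    forall y, `|x - y| < d -> `|f x - f y| < e / 2.
  have /cvgrPdist_lt /(_ _ e2) := cf x.
  move=> /nbhs_ballP[d /= d0 Hd]; exists d => // y xy.
  by apply: Hd; rewrite -ball_normE.
have d2 : 0 < d / 2 by rewrite divr_gt0.
have v1 : 0 < `|v| + 1 by rewrite ltr_wpDl.
have nv := near_step_lt L0 (divr_gt0 d2 v1).
near=> y P => t /= /andP[t0 tP].
have xy : `|x - y| < d / 2.
  by near: y; exact: cvgr_dist_lt.
have tv : `|t *: v| < d / 2.
  have tPd : 2 * L / P.+2%:R < d / 2 / (`|v| + 1) by near: P.
  have td : t < d / 2 / (`|v| + 1) by exact: le_lt_trans tPd.
  rewrite normrZ (ger0_norm t0); move: td; rewrite ltr_pdivlMr // => td.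
  by apply: le_lt_trans td; rewrite ler_wpM2l // lerDl.
have fy : `|f x - f y| < e / 2 by apply: dx; lra.
have fty : `|f x - f (t *: v + y)| < e / 2.
  apply: dx; rewrite opprD addrCA addrC.
  by apply: le_lt_trans (ler_normB _ _) _; lra.
rewrite (_ : f _ - f y = (f x - f y) - (f x - f (t *: v + y))); last by ring.
by apply: le_trans (ler_normB _ _) _; lra.
Unshelve. all: by end_near.
Qed.

Definition next P (i : 'I_n) (k : {ffun 'I_n -> 'I_P.+2}) :
    {ffun 'I_n -> 'I_P.+2} :=
  k + [ffun j => if j == i then 1 else 0].

Lemma next_bij P i : bijective (@next P i).
Proof.
exists (fun k => k - [ffun j => if j == i then 1 else 0]) => k.
  by rewrite /next addrK.
by rewrite /next subrK.
Qed.

(** Discrete divergence theorem. The node after [k] is the translate of the node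
    [k] by one step, except when the shift wraps around; then the two points lie
    on opposite faces of the cube, where [F] vanishes. Thus the sum is invariant under the
    translation, by reindexing. *)
Lemma sum_next L P (i : 'I_n) (F : 'rV[R]_n -> R) : 0 < L ->
    (forall x : 'rV[R]_n, L <= `|x 0 i| -> F x = 0) ->
  \sum_k (F ((2 * L / P.+2%:R) *: delta_mx 0 i + @node L P k) -
          F (node L k)) = 0.
Proof.
move=> L0 F0; rewrite sumrB [X in _ - X](reindex (@next P i)) /=; last first.
  exact/onW_bij/next_bij.
rewrite -sumrB big1 // => k _; apply/eqP; rewrite subr_eq0; apply/eqP.
have P0 : (P.+2%:R : R) != 0 by rewrite pnatr_eq0.
have [ki|ki] := eqVneq (k i).+1 P.+2.
  rewrite !F0 //; rewrite !mxE ?eqxx ?ffunE ?eqxx.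
    have -> : (k i + 1 : 'I_P.+2) = 0.
      by apply/val_inj; rewrite /= modnDmr addn1 ki modnn.
    by rewrite mulr0 mul0r sub0r mulrN1 normrN ger0_norm // ltW.
  have -> : (k i)%:R = P.+2%:R - 1 :> R.
    have := congr1 (fun j => j%:R : R) ki.
    by rewrite -natr1 => <-; rewrite addrK.
  rewrite (_ : _ + _ = L); first by rewrite ger0_norm // ltW.
  by rewrite /=; field.
congr F; apply/rowP => j; rewrite !mxE !ffunE /=.
have [->|ji] := eqVneq j i; last by rewrite mulr0 add0r addn0 modn_small.
rewrite modnDmr addn1 modn_small; last first.
  by rewrite ltn_neqAle ki ltn_ord.
by rewrite -[(k i).+1%:R]natr1 /=; field.
Qed.

(** By the mean value theorem and uniform continuity, [partial i F] is uniformly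
    close to a difference quotient of step the mesh size, whose sum over the
    grid is 0. *)
Lemma null_partial L (i : 'I_n) (F : 'rV[R]_n -> R) : 0 < L ->
    (forall x, derivable F x (delta_mx 0 i)) -> continuous (partial i F) ->
    (forall x : 'rV[R]_n, L <= `|x 0 i| -> F x = 0) ->
  null L (partial i F).
Proof.
move=> L0 dF cF F0; apply/cvgr0Pnorm_le => e e0.
have := near_box_translate (delta_mx 0 i) L0 cF e0.
apply: filterS => P HP.
set h := 2 * L / P.+2%:R.
have h0 : 0 < h by rewrite divr_gt0 ?mulr_gt0 ?ltr0n.
have E x : box L x ->
    `|partial i F x - h^-1 * (F (h *: delta_mx 0 i + x) - F x)| <= e.
  move=> xL; have [t th ->] := line_MVT x (ltW h0) dF.
  rewrite mulrCA mulVf ?gt_eqF // mulr1 distrC.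
  exact: HP.
have -> : mean L (partial i F) P =
    mean L (fun x =>
      partial i F x - h^-1 * (F (h *: delta_mx 0 i + x) - F x)) P.
  rewrite (_ : (fun x => partial i F x - _) =
    (fun x => partial i F x + - h^-1 * (F (h *: delta_mx 0 i + x) - F x))); last first.
    by apply/funext => x; rewrite mulNr.
  rewrite meanD meanZ [X in _ + _ * X](_ : _ = 0) ?mulr0 ?addr0 //.
  by rewrite /mean sum_next // mul0r.
rewrite ler_norml; apply/andP; split.
  rewrite -(mean_cst L (- e) P); apply: ler_mean => k.
  by have := E _ (node_box k (ltW L0)); rewrite ler_norml => /andP[].
rewrite -(mean_cst L e P); apply: ler_mean => k.
by have := E _ (node_box k (ltW L0)); rewrite ler_norml => /andP[].
Qed.

End Averages.

(** * The radial test function *)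

Section Bump.
Variables (R : realType) (n : nat).
Implicit Types (L : R) (x : 'rV[R]_n).

(** The square of the positive part is within [h^2] of its tangent at [t],
    whatever the signs of [t] and [t + h]. *)
Lemma is_derive_pos_sqr (t : R) :
  is_derive t (1 : R) (fun s : R => Num.max 0 s ^+ 2) (2 * Num.max 0 t).
Proof.
have H : (fun h : R =>
    h^-1 *: ((Num.max 0 (h *: (1 : R) + t)) ^+ 2 - Num.max 0 t ^+ 2)) @ 0^' -->
    (2 * Num.max 0 t : R).
  apply/cvgrPdist_le => e e0; near=> h.
  have h0 : h != 0 by near: h; exact: nbhs_dnbhs_neq.
  have he : `|h| <= e.
    rewrite -normrN -[- h]add0r.
    by near: h; apply: (@cvgr_dist_le _ _ _ _ _ id _ _ e e0); exact: cvg_within.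
  apply: le_trans he.
  rewrite /GRing.scale /= mulr1 distrC -[X in _ - X](mulKf h0) -mulrBr.
  rewrite normrM normfV.
  rewrite ler_pdivrMl ?normr_gt0 // -normrM -expr2 [leRHS]ger0_norm ?sqr_ge0 //.
  rewrite ler_norml; rewrite !maxEle.
  by apply/andP; case: ifP; case: ifP; split; nra.
by split; [apply/cvg_ex; exists (2 * Num.max 0 t) | apply: cvg_lim].
Unshelve. all: by end_near.
Qed.

Definition sqnorm x : R := \sum_i x 0 i ^+ 2.

Definition bump L x : R := Num.max 0 (1 - sqnorm x / L ^+ 2).

Lemma bump_ge0 L x : 0 <= bump L x.
Proof. by rewrite /bump le_max lexx. Qed.

Lemma sqnorm_ge0 x : 0 <= sqnorm x.
Proof. by apply: sumr_ge0 => i _; exact: sqr_ge0. Qed.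

Lemma bump_le1 L x : bump L x <= 1.
Proof.
by rewrite /bump ge_max ler01 /= gerBl divr_ge0 // ?sqnorm_ge0 ?sqr_ge0.
Qed.

Lemma bump_eq0 L (i : 'I_n) x : 0 < L -> L <= `|x 0 i| -> bump L x = 0.
Proof.
move=> L0 Lx; apply/max_idPl; rewrite subr_le0 ler_pdivlMr ?exprn_gt0 // mul1r.
rewrite /sqnorm (bigD1 i) //= -[leLHS]addr0 lerD //.
  by rewrite -[leRHS]real_normK ?num_real // lerXn2r // nnegrE ltW.
by apply: sumr_ge0 => j _; exact: sqr_ge0.
Qed.

(** On the support of [bump] the positive part can be dropped; this turns
    identities between polynomials into identities between powers of [bump]. *)
Lemma profileX_bump L x k :
  (1 - sqnorm x / L ^+ 2) ^+ k * bump L x = bump L x ^+ k.+1.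
Proof.
elim: k => [|k IH]; first by rewrite expr0 mul1r expr1.
rewrite exprS -mulrA IH.
by rewrite /bump maxEle; case: ifP => _; rewrite -?exprS // !exprS !mul0r mulr0.
Qed.

Lemma continuous_sum (I : Type) (r : seq I) (F : I -> 'rV[R]_n -> R) :
  (forall i, continuous (F i)) -> continuous (fun x => \sum_(i <- r) F i x).
Proof.
move=> cF; elim: r => [|i r IH] x.
  have -> : (fun y => \sum_(i <- [::]) F i y) = cst 0.
    by apply/funext => y; rewrite big_nil.
  exact: cst_continuous.
have -> : (fun y => \sum_(j <- i :: r) F j y) =
    F i \+ (fun y => \sum_(j <- r) F j y).
  by apply/funext => y; rewrite big_cons.
by apply: continuousD; [exact: cF | exact: IH].
Qed.

Lemma continuous_sqr_coord (i : 'I_n) : continuous (fun x => x 0 i ^+ 2 : R).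
Proof.
move=> x; apply: (@continuous_comp _ _ _ (fun y : 'rV[R]_n => y 0 i)
  (fun t : R => t ^+ 2)).
  exact: coord_continuous.
exact: exprn_continuous.
Qed.

Lemma continuous_sqnorm : continuous sqnorm.
Proof.
by apply: continuous_sum => i; exact: continuous_sqr_coord.
Qed.

Lemma continuous_bump L : continuous (bump L).
Proof.
have -> : bump L = cst 0 \max (fun x => 1 - sqnorm x / L ^+ 2) by [].
move=> x; apply: continuous_max; first exact: cst_continuous.
apply: continuousB; first exact: cst_continuous.
by apply: continuousM; [exact: continuous_sqnorm | exact: cst_continuous].
Qed.

Lemma continuous_bumpX L k : continuous (fun x => bump L x ^+ k).
Proof.
move=> x; apply: (@continuous_comp _ _ _ (bump L) (fun t : R => t ^+ k)).
  exact: continuous_bump.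
exact: exprn_continuous.
Qed.

Lemma is_derive_coord (i : 'I_n) x :
  is_derive x (delta_mx 0 i) (fun y => y 0 i : R) 1.
Proof.
rewrite -[x]add0r -(scale0r (delta_mx 0 i)); apply/is_derive_line.
rewrite (_ : (fun s => _) = (fun s : R => s + x 0 i)); last first.
  by apply/funext => s; rewrite !mxE !eqxx mulr1.
by apply: is_derive_eq; rewrite addr0.
Qed.

Lemma is_derive_profile L (i : 'I_n) x :
  is_derive x (delta_mx 0 i) (fun y => 1 - sqnorm y / L ^+ 2)
    (- 2 * x 0 i / L ^+ 2).
Proof.
rewrite -[x in is_derive x]add0r -(scale0r (delta_mx 0 i)).
apply/is_derive_line.
rewrite (_ : (fun s => _) = (fun s : R =>
    1 - (sqnorm x + (s * s + 2 * x 0 i * s)) / L ^+ 2)); last first.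
  apply/funext => s; rewrite /sqnorm (bigD1 i) //= [in RHS](bigD1 i) //=.
  rewrite (eq_bigr (fun j => x 0 j ^+ 2)); last first.
    by move=> j ji; rewrite !mxE (negPf ji) andbF mulr0 add0r.
  by rewrite !mxE !eqxx /=; ring.
by apply: is_derive_eq; rewrite /GRing.scale /=; ring.
Qed.

(** The power [bump^(k+2)] is the product of a polynomial, the profile to the
    power [k], and of the [C^1] function [bump^2]; a power 2 is needed since
    [bump] itself has a corner on the sphere. *)
Lemma is_derive_bumpX L (i : 'I_n) x k :
  is_derive x (delta_mx 0 i) (fun y => bump L y ^+ k.+2)
    (- 2 * k.+2%:R / L ^+ 2 * (x 0 i * bump L x ^+ k.+1)).
Proof.
have -> : (fun y => bump L y ^+ k.+2) =
    (fun y => 1 - sqnorm y / L ^+ 2) ^+ k * (fun y => bump L y ^+ 2).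
  apply/funext => y.
  by rewrite exprSr -profileX_bump -mulrA -expr2 exprfctE.
have D2 : is_derive x (delta_mx 0 i) (fun y => bump L y ^+ 2)
    (2 * bump L x * (- 2 * x 0 i / L ^+ 2)).
  rewrite -[x in is_derive x]add0r -(scale0r (delta_mx 0 i)).
  apply/is_derive_line.
  apply: (@is_derive1_comp _ (fun t : R => Num.max 0 t ^+ 2)).
    by rewrite scale0r add0r; exact: is_derive_pos_sqr.
  apply/(@is_derive_line _ _ (fun y => 1 - sqnorm y / L ^+ 2)).
  by rewrite scale0r add0r; exact: is_derive_profile.
have := is_deriveM (is_deriveX k (is_derive_profile L i x)) D2.
move/is_derive_eq; apply.
rewrite /GRing.scale /= exprfctE.
have H1 := profileX_bump L x k.
have H2 : k%:R * (1 - sqnorm x / L ^+ 2) ^+ k.-1 * bump L x ^+ 2 =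
    k%:R * bump L x ^+ k.+1.
  case: k {H1} => [|k]; first by rewrite !mul0r.
  rewrite -mulrA; congr (_ * _).
  by rewrite [bump L x ^+ 2]expr2 mulrA profileX_bump -exprSr.
set h := 1 - _ in H1 H2 *; set b := bump L x in H1 H2 *.
transitivity (2 * (h ^+ k * b) * (- 2 * x 0 i / L ^+ 2) +
   (k%:R * h ^+ k.-1 * b ^+ 2) * (- 2 * x 0 i / L ^+ 2)); first by ring.
by rewrite H1 H2 -[k.+2%:R]natr1 -[k.+1%:R]natr1; ring.
Qed.

Lemma partial_bumpX L (i : 'I_n) k :
  partial i (fun y => bump L y ^+ k.+2) =
  fun x => - 2 * k.+2%:R / L ^+ 2 * (x 0 i * bump L x ^+ k.+1).
Proof.
apply/funext => x.
exact: (derive_val (is_derive := is_derive_bumpX L i x k)).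
Qed.

Lemma is_derive_partial_bumpX L (i : 'I_n) x k :
  is_derive x (delta_mx 0 i) (partial i (fun y => bump L y ^+ k.+3))
    (- 2 * k.+3%:R / L ^+ 2 *
      (bump L x ^+ k.+2 -
       2 * k.+2%:R * (x 0 i ^+ 2 / L ^+ 2) * bump L x ^+ k.+1)).
Proof.
rewrite partial_bumpX.
have := is_deriveZ (- 2 * k.+3%:R / L ^+ 2)
  (is_deriveM (is_derive_coord i x) (is_derive_bumpX L i x k)).
move/is_derive_eq; apply.
by rewrite /GRing.scale /=; ring.
Qed.

(** The span of the powers of [bump] is stable under the Laplacian, because the
    factor [|x|^2 / L^2] produced by two derivatives equals [1 - bump] on the
    support. *)
Lemma laplacian_bumpX L x k : L != 0 ->
  laplacian (fun y => bump L y ^+ k.+3) x =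
  L ^- 2 * (4 * k.+3%:R * k.+2%:R * (bump L x ^+ k.+1 - bump L x ^+ k.+2)
    - 2 * n%:R * k.+3%:R * bump L x ^+ k.+2).
Proof.
move=> L0.
have H : sqnorm x / L ^+ 2 * bump L x ^+ k.+1 =
    bump L x ^+ k.+1 - bump L x ^+ k.+2.
  have := profileX_bump L x 1; rewrite expr1 => H.
  by rewrite -[k.+2]addn2 exprD -H [bump L x ^+ k.+1]exprSr; ring.
rewrite /laplacian (eq_bigr (fun i : 'I_n =>
  - 2 * k.+3%:R / L ^+ 2 * bump L x ^+ k.+2 +
    4 * k.+3%:R * k.+2%:R / L ^+ 2 / L ^+ 2 * bump L x ^+ k.+1 *
      x 0 i ^+ 2)); last first.
  move=> i _.
  rewrite [LHS](derive_val (is_derive := is_derive_partial_bumpX L i x k)).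
  by field.
rewrite big_split /= sumr_const card_ord -mulr_sumr -/(sqnorm x).
by rewrite -[_ *+ n]mulr_natr -H; field.
Qed.

(** Green's second identity: the function is the divergence of
    [phi grad w - w grad phi], where [phi = bump^(k+3)], and this field vanishes
    on the faces of the cube. The exponent is at least 3 because [bump^2] is
    not of class [C^2] on the sphere. *)
Lemma laplacian_green L (w : 'rV[R]_n -> R) k : 0 < L -> Ck 2 w ->
  null L (fun x => bump L x ^+ k.+3 * laplacian w x -
                   laplacian (fun y => bump L y ^+ k.+3) x * w x).
Proof.
move=> L0 [cw Dw].
pose g : 'rV[R]_n -> R := fun x => bump L x ^+ k.+3.
pose F i : 'rV[R]_n -> R := fun x => g x * partial i w x - partial i g x * w x.
have DF i x : is_derive x (delta_mx 0 i) (F i)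
    (g x * partial i (partial i w) x - partial i (partial i g) x * w x).
  have [dw [_ /(_ i)[dpw _]]] := Dw i.
  have Dg : is_derive x (delta_mx 0 i) g (partial i g x).
    apply: derivableP.
    exact: (ex_derive (is_derive := is_derive_bumpX L i x k.+1)).
  have Dpg : is_derive x (delta_mx 0 i) (partial i g)
      (partial i (partial i g) x).
    apply: derivableP.
    exact: (ex_derive (is_derive := is_derive_partial_bumpX L i x k)).
  have := is_deriveB (is_deriveM Dg (derivableP (dpw x)))
                     (is_deriveM Dpg (derivableP (dw x))).
  move/is_derive_eq; apply.
  by rewrite /GRing.scale /= /partial; ring.
rewrite (_ : (fun x => _) = (fun x => \sum_i partial i (F i) x)); last first.
  apply/funext => x; rewrite /laplacian mulr_sumr mulr_suml -sumrB.
  by apply: eq_bigr => i _; rewrite /partial (derive_val (is_derive := DF i x)).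
apply: null_sum => i; apply: null_partial => //.
- rewrite (_ : partial i (F i) = fun x =>
    g x * partial i (partial i w) x - partial i (partial i g) x * w x); last first.
    by apply/funext => x; exact: (derive_val (is_derive := DF i x)).
  have [_ [_ /(_ i)[_ [cppw _]]]] := Dw i.
  have cppg : continuous (partial i (partial i g)).
    rewrite (_ : partial i (partial i g) = fun x => - 2 * k.+3%:R / L ^+ 2 *
        (bump L x ^+ k.+2 -
         2 * k.+2%:R * (x 0 i ^+ 2 / L ^+ 2) * bump L x ^+ k.+1)); last first.
      apply/funext => y.
      exact: (derive_val (is_derive := is_derive_partial_bumpX L i y k)).
    have cc (c : R) : continuous (fun _ : 'rV[R]_n => c).
      exact: cst_continuous.
    move=> x.
    exact: (continuousM (cc _ x) (continuousB (@continuous_bumpX L k.+2 x)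
      (continuousM (continuousM (cc (2 * k.+2%:R) x)
        (continuousM (@continuous_sqr_coord i x) (cc (L ^- 2) x)))
        (@continuous_bumpX L k.+1 x)))).
  move=> x.
  exact: (continuousB (continuousM (@continuous_bumpX L k.+3 x) (cppw x))
                      (continuousM (cppg x) (cw x))).
- move=> x Lx; rewrite /F /g partial_bumpX (bump_eq0 L0 Lx).
  by rewrite !exprS !mul0r !mulr0 mul0r subr0.
Qed.

End Bump.

(** * Moving the polyharmonic operator onto the test function *)

Section Smoothness.
Variables (R : realType) (n : nat).
Implicit Types f g : 'rV[R]_n -> R.

Lemma Ck_pred k f : Ck k.+1 f -> Ck k f.
Proof.
elim: k f => [|k IH] f [cf Df]; split => // i.
by have [df Cf] := Df i; split => //; exact: IH.
Qed.

Lemma CkD k f g : Ck k f -> Ck k g -> Ck k (fun x => f x + g x).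
Proof.
elim: k f g => [|k IH] f g [cf Df] [cg Dg]; (split; first by
  move=> x; exact: (continuousD (cf x) (cg x))) => // i.
have [[df Cf] [dg Cg]] := (Df i, Dg i); split => [x|].
  exact: (derivableD (df x) (dg x)).
rewrite (_ : partial i _ = fun x => partial i f x + partial i g x).
  exact: IH.
by apply/funext => x; exact: (deriveD (df x) (dg x)).
Qed.

Lemma CkN k f : Ck k f -> Ck k (fun x => - f x).
Proof.
elim: k f => [|k IH] f [cf Df]; (split; first by
  move=> x; exact: (continuousN (cf x))) => // i.
have [df Cf] := Df i; split => [x|]; first exact: (derivableN (df x)).
rewrite (_ : partial i _ = fun x => - partial i f x); first exact: IH.
by apply/funext => x; exact: (deriveN (df x)).
Qed.

Lemma Ck0 k : Ck k (fun _ : 'rV[R]_n => 0 : R).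
Proof.
elim: k => [|k IH]; (split; first by move=> x; exact: cst_continuous) => // i.
split; first by move=> x; exact: derivable_cst.
rewrite (_ : partial i _ = fun=> 0) //.
by apply/funext => x; exact: derive_cst.
Qed.

Lemma Ck_sum k (I : Type) (r : seq I) (F : I -> 'rV[R]_n -> R) :
  (forall i, Ck k (F i)) -> Ck k (fun x => \sum_(i <- r) F i x).
Proof.
move=> CF; elim: r => [|i r IH].
  rewrite (_ : (fun x => _) = fun=> 0); first exact: Ck0.
  by apply/funext => x; rewrite big_nil.
rewrite (_ : (fun x => _) = fun x => F i x + \sum_(j <- r) F j x).
  exact: CkD.
by apply/funext => x; rewrite big_cons.
Qed.

Lemma Ck_laplacian k f : Ck k.+2 f -> Ck k (laplacian f).
Proof.
move=> [_ Df]; apply: Ck_sum => i.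
by have [_ [_ /(_ i)[]]] := Df i.
Qed.

Lemma Ck_polylaplacian m k f : Ck (k + 2 * m) f -> Ck k (polylaplacian m f).
Proof.
elim: m k => [|m IH] k; first by rewrite muln0 addn0.
by rewrite mulnS addnA => /IH; rewrite addn2 => /Ck_laplacian /CkN.
Qed.

(** The function [q] is [(-Delta)^m] applied to the test function: modulo null
    functions it replaces [(-Delta)^m f] by [f]. Each Laplacian costs two powers
    of [bump] and gains a factor [L^-2]. Keeping only the bound on [q] lets the
    induction peel off one Laplacian of [f] at a time: Green's formula replaces
    the exponent [k+3] by [k+1] and [k+2], to which the induction hypothesis
    applies with [j] and [j+1]. *)
Lemma polylaplacian_duality m j : exists2 C : R, 0 <= C &
  forall L f, 0 < L -> Ck (2 * m) f ->
  exists2 q : 'rV[R]_n -> R,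
    (forall x, `|q x| <= C * L ^- 2 ^+ m * bump L x ^+ j.+1) &
    null L (fun x =>
      bump L x ^+ (2 * m + j).+1 * polylaplacian m f x - q x * f x).
Proof.
elim: m j => [|m IH] j.
  exists 1 => // L f L0 Cf; exists (fun x => bump L x ^+ j.+1).
    by move=> x; rewrite expr0 !mul1r ger0_norm // exprn_ge0 // bump_ge0.
  rewrite (_ : (fun x => _) = fun=> 0); first exact: null0.
  by apply/funext => x; rewrite subrr.
have [C1 C10 H1] := IH j.
have [C2 C20 H2] := IH j.+1.
pose k := (2 * m + j)%N.
(* L^2 Delta bump^(k+3) = a bump^(k+1) - b bump^(k+2) *)
pose a : R := 4 * k.+3%:R * k.+2%:R.
pose b : R := a + 2 * n%:R * k.+3%:R.
have a0 : 0 <= a by rewrite !mulr_ge0.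
have b0 : 0 <= b by rewrite addr_ge0 // !mulr_ge0.
exists (a * C1 + b * C2); first by rewrite addr_ge0 // mulr_ge0.
move=> L f L0; rewrite mulnS add2n => Cf.
have Cf' := Ck_pred (Ck_pred Cf).
have [q1 q1b n1] := H1 L f L0 Cf'.
have [q2 q2b n2] := H2 L f L0 Cf'.
have Cw : Ck 2 (polylaplacian m f) by apply: Ck_polylaplacian; rewrite add2n.
have nw := @laplacian_green R n L _ k L0 Cw.
have Li : 0 <= L ^- 2 by rewrite invr_ge0 sqr_ge0.
exists (fun x => L ^- 2 * (b * q2 x - a * q1 x)).
  move=> x; have B0 := bump_ge0 L x.
  have q2x : `|q2 x| <= C2 * L ^- 2 ^+ m * bump L x ^+ j.+1.
    apply: le_trans (q2b x) _; rewrite ler_wpM2l ?mulr_ge0 ?exprn_ge0 //.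
    by rewrite exprS ler_piMl ?exprn_ge0 // bump_le1.
  rewrite normrM (ger0_norm Li) [L ^- 2 ^+ m.+1]exprS.
  rewrite [leRHS](_ : _ = L ^- 2 *
    (b * (C2 * L ^- 2 ^+ m * bump L x ^+ j.+1) +
     a * (C1 * L ^- 2 ^+ m * bump L x ^+ j.+1))); last by ring.
  rewrite ler_wpM2l //; apply: le_trans (ler_normB _ _) _.
  rewrite (normrM b) (normrM a) (ger0_norm a0) (ger0_norm b0).
  by rewrite lerD // ler_wpM2l.
have := nullD (nullD (nullZ (-1) nw) (nullZ (- (L ^- 2 * a)) n1))
  (nullZ (L ^- 2 * b) n2).
congr (null L _); apply/funext => x.
rewrite laplacian_bumpX ?gt_eqF // -/a -/k addnS -/k.
rewrite /polylaplacian iterS -/(polylaplacian m f).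
rewrite (_ : (2 * m).+2 + j = k.+2)%N //.
by rewrite /b; ring.
Qed.

End Smoothness.

(** * The test function has mean bounded below *)

(** The indices counted are those of the coordinates in [[0, L/(n+1)]]: a fixed
    proportion, close to [1/(2(n+1))], of all indices. *)
Lemma card_central_nodes n M : (2 * n.+1 <= M)%N ->
  (M <= #|[pred k : 'I_M | (M <= 2 * k)%N && ((2 * k - M) * n.+1 <= M)%N]| *
        (4 * n.+1))%N.
Proof.
move=> nM; set A := [pred k | _]; set q := (M %/ (2 * n.+1))%N.
have qM : (q * (2 * n.+1) <= M)%N by exact: leq_trunc_div.
have Mq : (M < q.+1 * (2 * n.+1))%N by rewrite ltn_ceil.
have q0 : (0 < q)%N by rewrite divn_gt0.
have jM (j : 'I_q) : (uphalf M + j < M)%N.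
  have := ltn_ord j; have := uphalf_half M; have := odd_double_half M; nia.
suff : (q <= #|A|)%N by nia.
pose f (j : 'I_q) := Ordinal (jM j).
have f_inj : injective f by move=> i j /(congr1 val)/= /addnI/val_inj.
have <- : #|codom f| = q by rewrite card_codom // card_ord.
apply: subset_leq_card; apply/fintype.subsetP => k /codomP[j ->].
rewrite inE /=.
have := ltn_ord j; have := uphalf_half M; have := odd_double_half M => h1 h2 h3.
apply/andP; split; nia.
Qed.

(** The bound [d] does not depend on [L], by homogeneity: [bump L] at a node
    only depends on the index of the node. On the small cube of side [L/(n+1)] with
    corner 0 one has [|x|^2 <= n L^2/(n+1)^2 <= L^2/2], so [bump] is at least
    [1/2] there. *)
Lemma mean_bumpX_ge (R : realType) n K : exists2 d : R, 0 < d <= 1 &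
  forall L : R, 0 < L ->
    \forall P \near \oo, d <= mean L (fun x : 'rV[R]_n => bump L x ^+ K) P.
Proof.
pose t : R := (4 * n.+1)%:R^-1.
have t0 : 0 < t by rewrite invr_gt0 ltr0n.
have t1 : t <= 1 by rewrite invf_le1 ?ltr0n // ler1n.
exists (t ^+ n * 2^-1 ^+ K).
  rewrite mulr_gt0 ?exprn_gt0 ?invr_gt0 //=.
  rewrite mulr_ile1 ?exprn_ge0 ?exprn_ile1 ?(ltW t0) ?invr_ge0 //; lra.
move=> L L0; near=> P.
have PM : (2 * n.+1 <= P.+2)%N.
  by apply: (@leq_trans P); last lia; near: P; exact: nbhs_infty_ge.
set A := [pred k : 'I_P.+2 |
  (P.+2 <= 2 * k)%N && ((2 * k - P.+2) * n.+1 <= P.+2)%N].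
have cA : t * P.+2%:R <= #|A|%:R.
  by rewrite /t mulrC ler_pdivrMr ?ltr0n // -natrM ler_nat card_central_nodes.
have bA (k : {ffun 'I_n -> 'I_P.+2}) : k \in ffun_on A ->
    2^-1 <= bump L (node L k).
  move=> /ffun_onP kA; rewrite /bump le_max; apply/orP; right.
  rewrite lerBrDr -lerBrDl ler_pdivrMr ?exprn_gt0 //.
  apply: (@le_trans _ _ (\sum_(i < n) (L / n.+1%:R) ^+ 2)).
    apply: ler_sum => i _; rewrite mxE !exprMn ler_wpM2l ?sqr_ge0 //.
    have /andP[k1 k2] := kA i.
    have k3 : 0 <= 2 * (k i)%:R / P.+2%:R - 1 :> R.
      by rewrite subr_ge0 ler_pdivlMr ?ltr0n // mul1r -natrM ler_nat.
    rewrite lerXn2r ?nnegrE ?invr_ge0 //.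
    rewrite lerBlDr ler_pdivrMr ?ltr0n // [leRHS]mulrDl mul1r -lerBlDr.
    rewrite ler_pdivlMl ?ltr0n // mulrC -natrM -natrB // -natrM ler_nat //.
  rewrite sumr_const card_ord exprMn -mulrnAr mulrC ler_wpM2r ?sqr_ge0 //.
  rewrite -[_ *+ n]mulr_natr exprVn mulrC ler_pdivrMr ?exprn_gt0 ?ltr0n //.
  rewrite -[n.+1%:R]natr1; have : 0 <= n%:R :> R by []. nra.
rewrite /mean ler_pdivlMr ?card_nodes_gt0 // card_ffun !card_ord natrX.
apply: (@le_trans _ _
  (\sum_(k : {ffun 'I_n -> 'I_P.+2} | k \in ffun_on A) 2^-1 ^+ K)).
  rewrite sumr_const card_ffun_on card_ord -[leRHS]mulr_natr natrX.
  rewrite mulrAC -exprMn mulrC.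
  rewrite ler_wpM2l ?exprn_ge0 ?invr_ge0 // lerXn2r ?nnegrE // mulr_ge0 // ltW //.
rewrite [leRHS](bigID (fun k => k \in ffun_on A)) /= -[leLHS]addr0 lerD //.
  apply: ler_sum => k /bA kA; rewrite lerXn2r ?nnegrE ?invr_ge0 ?bump_ge0 //.
by apply: sumr_ge0 => k _; rewrite exprn_ge0 ?bump_ge0.
Unshelve. all: by end_near.
Qed.

(** * Nonexistence *)

(** With [z = (y + M)/2 >= 0], [e^y = e^(-M) (e^z)^2 >= e^(-M) (1 + z)^2]. *)
Lemma expR_ge_quadratic (R : realType) (M : R) : 0 <= M ->
  exists2 c : R, 0 < c & forall y, - M <= y -> c * (1 + y ^+ 2) <= expR y.
Proof.
move=> M0; have M1 : 0 < 1 + M ^+ 2 by rewrite ltr_wpDr ?sqr_ge0.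
exists (expR (- M) / (4 * (1 + M ^+ 2))) => [|y My].
  by rewrite divr_gt0 ?expR_gt0 // mulr_gt0.
pose z := (y + M) / 2.
have z0 : 0 <= z by rewrite divr_ge0 //; lra.
have -> : expR y = expR (- M) * expR z ^+ 2.
  by rewrite -expRM_natl -expRD; congr expR; rewrite /z; field.
rewrite -mulrA ler_wpM2l ?expR_ge0 //.
apply: (@le_trans _ _ ((1 + z) ^+ 2)); last first.
  by rewrite lerXn2r ?nnegrE ?expR_ge0 ?addr_ge0 // expR_ge1Dx.
rewrite mulrC ler_pdivrMr ?mulr_gt0 //.
have -> : y = 2 * z - M by rewrite /z; field.
have Mz : 0 <= M * z by rewrite mulr_ge0.
have : 0 <= M ^+ 2 * z by rewrite mulr_ge0 ?sqr_ge0.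
have : 0 <= M ^+ 2 * z ^+ 2 by rewrite mulr_ge0 ?sqr_ge0.
have := sqr_ge0 M.
nra.
Qed.

Unset Implicit Arguments.

Theorem proposition2p1 (R : realType) (n m : nat) (hn : (1 <= n)%N)
    (hm : (1 <= m)%N) :
  ~ exists u : 'rV[R]_n -> R, entire_solution m u /\ has_lbound (range u).
Proof.
move=> [u [[Cu eq_u] [l lb]]].
have [c c0 exp_ge] := @expR_ge_quadratic R `|l| (normr_ge0 l).
have u_ge x : - `|l| <= u x.
  apply: le_trans (lb _ (imageT u x)).
  by rewrite lerNl -normrN ler_norm.
(* The test function is [bump^(2s)], with square root [bump^s]; [s] is large
   enough for [(-Delta)^m] of it, of order [bump^(2s - 2m)], to be controlled by
   this square root. *)
pose s := (2 * m).+1.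
have [C C0 dual] := @polylaplacian_duality R n m s.
have [d /andP[d0 d1] mean_ge] := @mean_bumpX_ge R n (2 * s).
(* [L >= C / (c d)] makes the remainder [(C L^(-2m))^2 / (4c)] at most
   [c d / 4]. *)
pose L := 1 + C / (c * d).
have cd0 : 0 < c * d by rewrite mulr_gt0.
have L1 : 1 <= L by rewrite lerDl divr_ge0 // ltW.
have L0 : 0 < L by apply: lt_le_trans L1.
have [q qb nq] := dual L u L0 Cu.
have D_le : C * L ^- 2 ^+ m <= c * d.
  have : C <= L * (c * d).
    by rewrite mulrDl mul1r divfK ?gt_eqF // lerDr ltW.
  rewrite -ler_pdivrMl // => CL; apply: le_trans CL.
  rewrite -exprVn -exprM mulrC ler_wpM2r //.
  rewrite exprVn lef_pV2 ?posrE ?exprn_gt0 //.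
  by apply: ler_eXnr => //; lia.
have q_le x : `|q x| <= c * d * bump L x ^+ s.
  apply: le_trans (qb x) _; have B0 := bump_ge0 L x.
  apply: ler_pM => //.
  - by rewrite mulr_ge0 // exprn_ge0 // invr_ge0 sqr_ge0.
  - by rewrite exprn_ge0.
  - by rewrite exprS ler_piMl ?exprn_ge0 // bump_le1.
(* Young's inequality absorbs [q u] into [c bump^(2s) u^2]. *)
have low x : c * bump L x ^+ (2 * s) - c * d / 4 <=
    bump L x ^+ (2 * m + s).+1 * polylaplacian m u x - q x * u x.
  rewrite (_ : (2 * m + s).+1 = (2 * s))%N; last by rewrite /s; lia.
  rewrite eq_u mulnC exprM; have := q_le x; have := exp_ge _ (u_ge x).
  have : 0 <= bump L x ^+ s by rewrite exprn_ge0 // bump_ge0.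
  move: (bump L x ^+ s) (u x) (q x) (expR (u x)) => B v p E B0 cE pB.
  have pv : p * v <= c * d * B * `|v|.
    by apply: le_trans (ler_norm _) _; rewrite normrM ler_wpM2r.
  have BE : c * B ^+ 2 + c * (B * `|v|) ^+ 2 <= B ^+ 2 * E.
    rewrite exprMn real_normK ?num_real //.
    apply: le_trans (ler_wpM2l (sqr_ge0 B) cE).
    by rewrite le_eqVlt; apply/orP; left; apply/eqP; ring.
  have sq : 0 <= c * (B * `|v| - d / 2) ^+ 2 by rewrite mulr_ge0 ?sqr_ge0 // ltW.
  have dd : c * d ^+ 2 <= c * d.
    by rewrite ler_pM2l // expr2 ler_piMl // ltW.
  nra.
pose N x := bump L x ^+ (2 * m + s).+1 * polylaplacian m u x - q x * u x.
have : \forall P \near \oo, False.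
  have nq0 : \forall P \near \oo, `|mean L N P| < c * d / 2.
    by have /cvgr0Pnorm_lt := nq; apply; rewrite divr_gt0.
  near=> P.
  have : c * d / 2 < mean L N P.
    apply: (@lt_le_trans _ _
      (mean L (fun x => c * bump L x ^+ (2 * s) + - (c * d / 4)) P)).
      rewrite meanD meanZ mean_cst.
      have : c * d <= c * mean L (fun x : 'rV[R]_n => bump L x ^+ (2 * s)) P.
        by rewrite ler_pM2l //; near: P; exact: mean_ge.
      lra.
    by apply: ler_mean => k; exact: low.
  apply/negP; rewrite -leNgt ltW //; apply: le_lt_trans (ler_norm _) _.
  by near: P.
by move=> [M _ /(_ M)]; apply; rewrite /=.
Unshelve. all: by end_near.
Qed.
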